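(* Let $0<p_0,p_1,q_0,q_1\le\infty$, $s\in\mathbb R$, $t>0$ with $t>d(1/p_0-1/p_1)_+$, and let $\mathcal B=(e_{j,\lambda})$ be the canonical unit-vector basis. Then $$ \sup\big\{\sigma_n(a,\mathcal B)_{b^s_{p_1,q_1}}:\ \|a\|_{b^{s+t}_{p_0,q_0}}\le1\big\}\asymp n^{-t/d}. $$
   Context: Sequence spaces: $\nabla=(\nabla_j)_{j\ge0}$ finite subsets of $\{1,\dots,2^d-1\}\times\mathbb Z^d$ with $C_1\le2^{-jd}|\nabla_j|\le C_2$ for all $j\ge J$ (some $0<C_1\le C_2$, $J\in\mathbb N$); $b^s_{p,q}=b^s_{p,q}(\nabla)$ is the space of sequences $a=(a_{j,\lambda})$ with $\|a\|_{b^s_{p,q}}=\big(\sum_{j\ge0}2^{j(s+d(1/2-1/p))q}(\sum_{\lambda\in\nabla_j}|a_{j,\lambda}|^p)^{q/p}\big)^{1/q}<\infty$ (sup if $q=\infty$). $e_{j,\lambda}$ is the sequence with entry $1$ at position $(j,\lambda)$ and $0$ elsewhere. For a quasi-normed space $X$ and $\mathcal B=\{h_i\}\subset X$, $\sigma_n(u,\mathcal B)_X=\inf_{i_1,\dots,i_n}\inf_{c_1,\dots,c_n}\|u-\sum_{k=1}^nc_kh_{i_k}\|_X$. $\asymp$: two-sided bounds with constants independent of $n$. *)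

(* Defs.v *)
From HB Require Import structures.
From mathcomp Require Import all_boot all_order all_algebra.
From mathcomp Require Import finmap.
From mathcomp Require Import all_classical all_reals all_analysis.
Set Implicit Arguments. Unset Strict Implicit. Unset Printing Implicit Defensive.
Import Order.TTheory GRing.Theory Num.Theory.
Local Open Scope ring_scope.
Local Open Scope fset_scope.

(* spatial index lambda = (e, k) with e in {1..2^d-1}, k in Z^d *)
Definition sidx (d : nat) := (nat * 'rV[int]_d)%type.

Definition index_family (d : nat) (nabla : nat -> {fset sidx d}) : Prop :=
  forall j (l : sidx d), l \in nabla j -> (1 <= l.1 <= 2 ^ d - 1)%N.

Definition nabla_growth (R : realType) (d : nat) (nabla : nat -> {fset sidx d}) : Prop :=
  exists (C1 C2 : R) (J : nat), 0 < C1 /\ C1 <= C2 /\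
    forall j, (J <= j)%N ->
      C1 <= (2%:R ^- (j * d)) * (#|` nabla j|)%:R <= C2.

Definition einv (R : realType) (p : \bar R) : R :=
  if p is r%:E then r^-1 else 0.

(* sequences a = (a_{j,lambda}); entries off nabla are irrelevant *)
Definition seqsp (R : realType) (d : nat) := nat -> sidx d -> R.

Definition lp_level (R : realType) d (nabla : nat -> {fset sidx d})
    (p : \bar R) (a : seqsp R d) (j : nat) : R :=
  match p with
  | r%:E => (\sum_(l <- nabla j) (`|a j l| `^ r)) `^ r^-1
  | _ => \big[Num.max/0]_(l <- nabla j) `|a j l|
  end.

Definition bnorm (R : realType) d (nabla : nat -> {fset sidx d})
    (s : R) (p q : \bar R) (a : seqsp R d) : \bar R :=
  let c j := (2 `^ (j%:R * (s + d%:R * (2^-1 - einv p)))) * lp_level nabla p a j in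
  match q with
  | r%:E => poweR (\sum_(j <oo) ((c j) `^ r)%:E)%E r^-1
  | _ => ereal_sup (range (fun j => (c j)%:E))
  end.

Definition unitvec (R : realType) d (j : nat) (l : sidx d) : seqsp R d :=
  fun j' l' => if (j' == j) && (l' == l) then 1 else 0.

Definition sigma_n (R : realType) d (nabla : nat -> {fset sidx d})
    (s : R) (p q : \bar R) (n : nat) (u : seqsp R d) : \bar R :=
  ereal_inf [set x | exists (idx : 'I_n -> nat * sidx d) (c : 'I_n -> R),
     (forall k, (idx k).2 \in nabla (idx k).1) /\
     x = bnorm nabla s p q
           (fun j l => u j l - \sum_(k < n) c k * unitvec R (idx k).1 (idx k).2 j l)].

Definition worst_sigma (R : realType) d (nabla : nat -> {fset sidx d})
    (s t : R) (p0 q0 p1 q1 : \bar R) (n : nat) : \bar R :=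
  ereal_sup [set sigma_n nabla s p1 q1 n a | a in
               [set a : seqsp R d | (bnorm nabla (s + t) p0 q0 a <= 1)%E]].

(* Main.v *)
(* Upper bound.  Fix a real number kappa with 2^(kappa d) equal to a small
   multiple of n.  On the levels j < kappa keep every coefficient; on a level
   j >= kappa keep those above the threshold for which at most
   C 2^(kappa d - delta (j - kappa)) of them survive, with delta > 0 small.  The
   numbers of kept coefficients decay geometrically away from kappa and add up to
   at most n.  The weighted l_p1 norm of what is left on level j is
   O(2^(-kappa t) 2^(-eta |j - kappa|)) with
   eta = t - (d + delta) (1/p0 - 1/p1)_+ > 0, so that the l_q1 norm over the
   levels is O(2^(-kappa t)) = O(n^(-t/d)).  Since the estimate only uses
   sup_j of the level norms of the source, q0 plays no role.

   Lower bound.  Take a sequence constant on a single level with at least 2n and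
   O(n) positions: any n-term combination leaves n of its entries unchanged. *)
Require Import Defs.
From HB Require Import structures.
From mathcomp Require Import all_boot all_order all_algebra.
From mathcomp Require Import finmap.
From mathcomp Require Import all_classical all_reals all_analysis.
From mathcomp Require Import zify ring lra.
Import Order.TTheory GRing.Theory Num.Theory.
Local Open Scope ring_scope.

(** * Powers of two and geometric sums centred at a real point *)

Lemma pow2D (R : realType) (x y : R) : 2 `^ (x + y) = 2 `^ x * 2 `^ y.
Proof. by apply: powRD; apply/implyP => _; rewrite pnatr_eq0. Qed.

Lemma pow2_gt0 (R : realType) (x : R) : 0 < 2 `^ x.
Proof. exact: powR_gt0. Qed.

Lemma pow2_le1 (R : realType) (x : R) : x <= 0 -> 2 `^ x <= 1.
Proof. by move=> x0; rewrite -[leRHS](powRr0 2) ler_powR// ler1n. Qed.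

Lemma pow2_lt1 (R : realType) (x : R) : x < 0 -> 2 `^ x < 1.
Proof.
move=> x0; rewrite /powR pnatr_eq0/= -[ltRHS]expR0 ltr_expR.
by rewrite nmulr_rlt0// ln_gt0// ltr1n.
Qed.

Definition geo_bound (R : realType) (eta : R) : R := 2 / (1 - 2 `^ (- eta)).

Lemma geo_bound_gt0 (R : realType) (eta : R) : 0 < eta -> 0 < geo_bound R eta.
Proof. by move=> e0; rewrite divr_gt0// subr_gt0 pow2_lt1// oppr_lt0. Qed.

(** On each side of [kappa] the terms are dominated by a geometric series of ratio [2 ^ (- eta)]
    with first term at most 1. The point is a bound uniform in [N] and in the real centre
    [kappa]. *)
Lemma geo_sum (R : realType) (kappa eta : R) (N : nat) : 0 < eta ->
  \sum_(0 <= j < N) 2 `^ (- (eta * `|j%:R - kappa|)) <= geo_bound R eta.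
Proof.
move=> e0.
have rho1 : 2 `^ (- eta) < 1 by rewrite pow2_lt1// oppr_lt0.
rewrite ler_pdivlMr ?subr_gt0//.
set rho := 2 `^ (- eta) in rho1 *.
(* Exact partial sums of the two geometric series, started at -oo. *)
suff H : (\sum_(0 <= j < N) 2 `^ (- (eta * `|j%:R - kappa|))) * (1 - rho)
  <= if N%:R <= kappa then 2 `^ (- (eta * (kappa - N%:R + 1)))
     else 2 - 2 `^ (- (eta * (N%:R - kappa))).
  apply: (le_trans H); case: ifP => Nk.
    apply: (@le_trans _ _ 1); last by rewrite ler1n.
    by apply: pow2_le1; rewrite oppr_le0 mulr_ge0// ?(ltW e0)//; lra.
  by rewrite gerBl ltW// pow2_gt0.
elim: N => [|N IH].
  rewrite big_geq// mul0r; case: ifP => k0; first by rewrite ltW// pow2_gt0.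
  rewrite subr_ge0 (@le_trans _ _ 1) ?ler1n//; apply: pow2_le1.
  move/negbT: k0; rewrite -ltNge sub0r => k0.
  by rewrite oppr_le0 mulr_ge0 ?(ltW e0) ?oppr_ge0 ?ltW.
rewrite big_nat_recr//= mulrDl.
move: IH; have [Nk|kN] := leP N%:R kappa => IH.
  rewrite ler0_norm ?subr_le0// opprB.
  have E : 2 `^ (- (eta * (kappa - N%:R + 1)))
      = 2 `^ (- (eta * (kappa - N%:R))) * rho.
    by rewrite -pow2D; congr (2 `^ _); ring.
  rewrite E in IH.
  have IH' : (\sum_(0 <= j < N) 2 `^ (- (eta * `|j%:R - kappa|))) * (1 - rho) +
     2 `^ (- (eta * (kappa - N%:R))) * (1 - rho)
     <= 2 `^ (- (eta * (kappa - N%:R))) by lra.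
  apply: (le_trans IH'); case: ifP => [_|/negbT].
    by rewrite -natr1 le_eqVlt; apply/orP; left; apply/eqP; congr (2 `^ _); ring.
  rewrite -ltNge => kN.
  (* Here [kappa] lies between [N] and [N.+1], where the closed form changes; the old and the new
     expression are compared through the value 1. *)
  have A : 2 `^ (- (eta * (kappa - N%:R))) <= 1.
    by apply: pow2_le1; rewrite oppr_le0 mulr_ge0// ?(ltW e0)// subr_ge0.
  have B : 2 `^ (- (eta * (N.+1%:R - kappa))) <= 1.
    by apply: pow2_le1; rewrite oppr_le0 mulr_ge0// ?(ltW e0)// subr_ge0 ltW.
  by lra.
have -> : (N.+1%:R <= kappa) = false.
  by apply/negbTE; rewrite -ltNge (lt_le_trans kN)// ler_nat.
rewrite gtr0_norm ?subr_gt0//.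
have -> : 2 `^ (- (eta * (N.+1%:R - kappa)))
    = 2 `^ (- (eta * (N%:R - kappa))) * rho.
  by rewrite -pow2D -natr1; congr (2 `^ _); ring.
by lra.
Qed.

(** * The quasi-norm [bnorm] and its single levels *)

(** This is the local [c] of [bnorm], named so that levels can be estimated one at a time. *)
Definition weighted_level (R : realType) d (nabla : nat -> {fset sidx d}) (s : R)
  (p : \bar R) (a : seqsp R d) (j : nat) : R :=
  (2 `^ (j%:R * (s + d%:R * (2^-1 - einv p)))) * lp_level nabla p a j.

Lemma einv_ge0 (R : realType) (p : \bar R) : (0 < p)%E -> 0 <= einv p.
Proof. by case: p => [r| |] //=; rewrite lte_fin invr_ge0 => /ltW. Qed.

Lemma lp_level_ge0 (R : realType) d (nabla : nat -> {fset sidx d})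
  (p : \bar R) (a : seqsp R d) (j : nat) : 0 <= lp_level nabla p a j.
Proof. by case: p => [r| |] /=; rewrite ?powR_ge0 ?bigmax_ge_id. Qed.

Lemma weighted_level_ge0 (R : realType) d (nabla : nat -> {fset sidx d}) (s : R)
  (p : \bar R) (a : seqsp R d) (j : nat) : 0 <= weighted_level R d nabla s p a j.
Proof. by rewrite mulr_ge0 ?powR_ge0 ?lp_level_ge0. Qed.

(** One term of a nonnegative series is below its sum, and taking roots is monotone. This extracts
    level bounds from the unit ball and, in the lower bound, isolates one level of the error. *)
Lemma weighted_level_le_bnorm (R : realType) d (nabla : nat -> {fset sidx d}) (s : R)
  (p q : \bar R) (a : seqsp R d) (j : nat) : (0 < q)%E ->
  ((weighted_level R d nabla s p a j)%:E <= bnorm nabla s p q a)%E.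
Proof.
rewrite /bnorm -/(weighted_level R d nabla s p a); case: q => [r| |] //= q0; last first.
  by apply: ereal_sup_ubound; exists j.
rewrite lte_fin in q0.
have c0 i : 0 <= weighted_level R d nabla s p a i by exact: weighted_level_ge0.
have -> : (weighted_level R d nabla s p a j)%:E
    = poweR ((weighted_level R d nabla s p a j `^ r)%:E) r^-1.
  by rewrite poweR_EFin -powRrM mulfV ?gt_eqF// powRr1.
apply: gt0_ler_poweR; rewrite ?invr_ge0 ?(ltW q0)//.
- by rewrite in_itv/= leey andbT lee_fin powR_ge0.
- rewrite in_itv/= leey andbT; apply: nneseries_ge0 => n _ _.
  by rewrite lee_fin powR_ge0.
apply: le_trans (@nneseries_lim_ge _ _ xpredT 0%N j.+1 _) => /=; last first.
  by move=> i _ _; rewrite lee_fin powR_ge0.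
rewrite big_nat_recr//= leeDr//.
by apply: sume_ge0 => i _; rewrite lee_fin powR_ge0.
Qed.

(** A bound for the l_q quasi-norm of the sequence [2 ^ (- eta |j - kappa|)], independent of
    [kappa]. *)
Definition bnorm_const (R : realType) (eta : R) (q : \bar R) : R :=
  if q is r%:E then geo_bound R (eta * r) `^ r^-1 else 1.

Lemma bnorm_const_gt0 (R : realType) (eta : R) (q : \bar R) :
  0 < eta -> (0 < q)%E -> 0 < bnorm_const R eta q.
Proof.
move=> e0; case: q => [r| |] //= q0.
by rewrite powR_gt0// geo_bound_gt0// mulr_gt0.
Qed.

(** Raising to the power [r] only changes the decay rate from [eta] to [eta * r], so [geo_sum]
    controls all partial sums. No triangle inequality enters, which covers [q < 1]. *)
Lemma bnorm_le (R : realType) d (nabla : nat -> {fset sidx d}) (s : R)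
  (p q : \bar R) (a : seqsp R d) (M kappa eta : R) :
  (0 < q)%E -> 0 < eta -> 0 <= M ->
  (forall j, weighted_level R d nabla s p a j <= M * 2 `^ (- (eta * `|j%:R - kappa|))) ->
  (bnorm nabla s p q a <= (M * bnorm_const R eta q)%:E)%E.
Proof.
move=> q0 e0 M0 H.
have c0 i : 0 <= weighted_level R d nabla s p a i by exact: weighted_level_ge0.
rewrite /bnorm -/(weighted_level R d nabla s p a); case: q q0 => [r| |] //= q0; last first.
  apply: ge_ereal_sup => _ [j _ <-]; rewrite lee_fin (le_trans (H j))//.
  by rewrite ler_wpM2l// pow2_le1// oppr_le0 mulr_ge0// ltW.
rewrite lte_fin in q0.
have G0 : 0 < geo_bound R (eta * r) by rewrite geo_bound_gt0// mulr_gt0.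
have -> : (M * geo_bound R (eta * r) `^ r^-1)%:E
    = poweR ((M `^ r * geo_bound R (eta * r))%:E) r^-1.
  rewrite poweR_EFin powRM ?powR_ge0 ?(ltW G0)// -powRrM mulfV ?gt_eqF//.
  by rewrite powRr1.
have u0 j : (0 <= (weighted_level R d nabla s p a j `^ r)%:E)%E by rewrite lee_fin powR_ge0.
apply: gt0_ler_poweR; rewrite ?invr_ge0 ?(ltW q0)//.
- by rewrite in_itv/= leey andbT; apply: nneseries_ge0 => n _ _; exact: u0.
- by rewrite in_itv/= leey andbT lee_fin mulr_ge0 ?powR_ge0 ?(ltW G0).
apply: lime_le; first by apply: is_cvg_nneseries => n _ _; exact: u0.
apply: nearW => N; rewrite sumEFin lee_fin.
apply: (@le_trans _ _ (\sum_(0 <= j < N) M `^ r *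
    2 `^ (- ((eta * r) * `|j%:R - kappa|)))); last first.
  by rewrite -mulr_sumr ler_wpM2l ?powR_ge0// geo_sum// mulr_gt0.
apply: ler_sum => j _.
have -> : 2 `^ (- (eta * r * `|j%:R - kappa|))
    = (2 `^ (- (eta * `|j%:R - kappa|))) `^ r.
  by rewrite -powRrM; congr (2 `^ _); ring.
rewrite -powRM ?powR_ge0//; apply: ge0_ler_powR => //.
- exact: ltW.
- by rewrite nnegrE; exact: c0.
- by rewrite nnegrE mulr_ge0 ?powR_ge0.
- exact: H.
Qed.

(** * Counting and threshold estimates on one level *)

Lemma sum_const_count (R : realType) (T : Type) (P : pred T) (s : seq T) (c : R) :
  \sum_(l <- s | P l) c = (count P s)%:R * c.
Proof. by rewrite big_const_seq iter_addr_0 mulr_natl. Qed.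

Lemma sum_powR_ge0 (R : realType) (T : Type) (s : seq T) (f : T -> R) (r : R) :
  0 <= \sum_(l <- s) f l `^ r.
Proof. by apply: sumr_ge0 => l _; exact: powR_ge0. Qed.

(** Chebyshev's inequality for the counting measure. *)
Lemma count_powR_le (R : realType) (T : Type) (s : seq T) (f : T -> R) (x r : R) :
  0 <= x -> 0 <= r ->
  (count (fun l => x <= `|f l|) s)%:R * x `^ r <= \sum_(l <- s) `|f l| `^ r.
Proof.
move=> x0 r0; rewrite -sum_const_count big_mkcond/=.
apply: ler_sum => l _; case: ifP => [xf|_]; last exact: powR_ge0.
by apply: ge0_ler_powR; rewrite ?nnegrE.
Qed.

Lemma powRK (R : realType) (x r : R) : r != 0 -> 0 <= x -> (x `^ r) `^ r^-1 = x.
Proof. by move=> r0 x0; rewrite -powRrM mulfV// powRr1. Qed.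

Lemma powRVK (R : realType) (x r : R) : r != 0 -> 0 <= x -> (x `^ r^-1) `^ r = x.
Proof. by move=> r0 x0; rewrite -powRrM mulVf// powRr1. Qed.

Lemma powR_inv_le (R : realType) (x y r : R) :
  0 < r -> 0 <= x -> 0 <= y -> (x `^ r^-1 <= y) = (x <= y `^ r).
Proof.
move=> r0 x0 y0; have rN0 : r != 0 by rewrite gt_eqF.
apply/idP/idP => H.
  rewrite -(powRVK _ x r rN0 x0).
  by apply: ge0_ler_powR; rewrite ?nnegrE ?powR_ge0// ltW.
rewrite -(powRK _ y r rN0 y0).
by apply: ge0_ler_powR; rewrite ?nnegrE ?powR_ge0// invr_ge0 ltW.
Qed.

Lemma le_powR_inv (R : realType) (x y r : R) :
  0 < r -> 0 <= x -> 0 <= y -> (y <= x `^ r^-1) = (y `^ r <= x).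
Proof.
move=> r0 x0 y0; have rN0 : r != 0 by rewrite gt_eqF.
apply/idP/idP => H.
  rewrite -(powRVK _ x r rN0 x0).
  by apply: ge0_ler_powR; rewrite ?nnegrE ?powR_ge0// ltW.
rewrite -(powRK _ y r rN0 y0).
by apply: ge0_ler_powR; rewrite ?nnegrE ?powR_ge0// invr_ge0 ltW.
Qed.

Lemma lp_level_le (R : realType) d (nabla : nat -> {fset sidx d}) (p : \bar R)
  (a : seqsp R d) (j : nat) (M N : R) :
  (0 < p)%E -> 0 <= M -> (#|` nabla j|)%:R <= N ->
  (forall l, l \in nabla j -> `|a j l| <= M) ->
  lp_level nabla p a j <= M * N `^ einv p.
Proof.
move=> p0 M0 HN H; have N0 : 0 <= N := le_trans (ler0n _ _) HN.
case: p p0 => [r| |] //= p0; last first.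
  by rewrite powRr0 mulr1 big_seq; apply: bigmax_le.
rewrite lte_fin in p0.
rewrite powR_inv_le ?sum_powR_ge0 ?mulr_ge0 ?powR_ge0//.
rewrite powRM ?powR_ge0// -powRrM mulVf ?gt_eqF// powRr1//.
apply: (@le_trans _ _ (\sum_(l <- nabla j) M `^ r)).
  rewrite !big_seq; apply: ler_sum => l lj.
  by apply: ge0_ler_powR; rewrite ?nnegrE ?(ltW p0)//; exact: H.
by rewrite sum_const_count count_predT mulrC ler_wpM2l ?powR_ge0.
Qed.

Lemma lp_level_ge (R : realType) d (nabla : nat -> {fset sidx d}) (p : \bar R)
  (a : seqsp R d) (j : nat) (M N : R) :
  (0 < p)%E -> 0 <= M -> 0 < N ->
  N <= (count (fun l => M <= `|a j l|) (nabla j))%:R ->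
  M * N `^ einv p <= lp_level nabla p a j.
Proof.
move=> p0 M0 N0 HN.
case: p p0 => [r| |] //= p0; last first.
  have /hasP[l lj Ml] : has (fun l => M <= `|a j l|) (nabla j).
    by rewrite has_count -(ltr_nat R) (lt_le_trans N0).
  rewrite powRr0 mulr1; apply: (le_trans Ml).
  exact: (@le_bigmax_seq _ _ _ _ _ _ xpredT (fun l => `|a j l|) lj).
rewrite lte_fin in p0.
rewrite le_powR_inv ?sum_powR_ge0 ?mulr_ge0 ?powR_ge0//.
rewrite powRM ?powR_ge0// -powRrM mulVf ?gt_eqF// powRr1 ?(ltW N0)//.
rewrite mulrC; apply: le_trans (count_powR_le _ _ _ _ _ _ M0 (ltW p0)).
by rewrite ler_wpM2r ?powR_ge0.
Qed.

Lemma powR_expR (R : realType) (x y : R) : 0 < x -> x `^ y = expR (y * ln x).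
Proof. by move=> x0; rewrite /powR gt_eqF. Qed.

Lemma level_approx (R : realType) d (nabla : nat -> {fset sidx d})
  (p0 p1 : \bar R) (a : seqsp R d) (j : nat) (M x N : R) :
  (0 < p0)%E -> (0 < p1)%E -> 0 < M -> 0 < x -> 0 < N ->
  (#|` nabla j|)%:R <= N -> lp_level nabla p0 a j <= M ->
  exists P : pred (sidx d), (count P (nabla j))%:R <= x /\
    forall b : seqsp R d,
      (forall l, l \in nabla j -> b j l = if P l then 0 else a j l) ->
      lp_level nabla p1 b j <= 2 `^ einv p1 * M *
        x `^ (- Num.max (einv p0 - einv p1) 0) *
        N `^ Num.max (einv p1 - einv p0) 0.
Proof.
move=> p00 p10 M0 x0 N0 HN Ha.
have K1 : 1 <= 2 `^ einv p1 :> R.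
  by rewrite -[leLHS](powRr0 2) ler_powR ?ler1n ?einv_ge0.
case: p0 p00 Ha => [r0| |] //= p00 Ha; last first.
  (* For infinite [p0] every entry is already at most [M], so nothing is kept. *)
  exists pred0; rewrite count_pred0; split; first exact: ltW.
  move=> b Hb; rewrite sub0r subr0.
  have e1 := einv_ge0 R p1 p10.
  rewrite max_r ?oppr_le0// max_l// oppr0 powRr0 mulr1.
  apply: (@le_trans _ _ (M * N `^ einv p1)).
    apply: lp_level_le => //; first exact: ltW.
    move=> l lj; rewrite Hb//=; apply: le_trans Ha.
    exact: (@le_bigmax_seq _ _ _ _ _ _ xpredT (fun l => `|a j l|) lj).
  by rewrite ler_wpM2r ?powR_ge0// ler_peMl// ltW.
rewrite lte_fin in p00.
rewrite powR_inv_le ?sum_powR_ge0 ?(ltW M0)// in Ha.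
(* Entries above [T] number at most [x] by Chebyshev's inequality. *)
pose T := M * x `^ (- r0^-1).
have T0 : 0 < T by rewrite mulr_gt0 ?powR_gt0.
have cnt : (count (fun l => T <= `|a j l|) (nabla j))%:R <= x.
  rewrite -(ler_pM2r (powR_gt0 r0 T0)).
  apply: le_trans (count_powR_le _ _ _ _ _ _ (ltW T0) (ltW p00)) _.
  apply: (le_trans Ha); rewrite /T powRM ?powR_ge0 ?(ltW M0)// -powRrM.
  rewrite mulNr mulVf ?gt_eqF// powR_inv1 ?(ltW x0)// mulrCA mulfV ?gt_eqF//.
  by rewrite mulr1.
case: p1 p10 K1 => [r1| |] //= p10 K1; last first.
  exists (fun l => T <= `|a j l|); split => // b Hb.
  have i0 : 0 <= r0^-1 by rewrite invr_ge0 ltW.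
  rewrite subr0 sub0r max_l// max_r ?oppr_le0// !powRr0 mul1r mulr1 -/T.
  rewrite big_seq; apply: bigmax_le => [|l lj]; first exact: ltW.
  rewrite Hb//; case: ifP => [_|/negbT]; first by rewrite normr0 ltW.
  by rewrite -ltNge => /ltW.
rewrite lte_fin in p10.
have [r01|r10] := ltP r0 r1.
  exists (fun l => T <= `|a j l|); split => // b Hb.
  have ii : r1^-1 <= r0^-1 by rewrite lef_pV2 ?posrE// ltW.
  rewrite max_l ?subr_ge0// max_r ?subr_le0// powRr0 mulr1.
  have B0 : 0 < M * x `^ (- (r0^-1 - r1^-1)) by rewrite mulr_gt0 ?powR_gt0.
  rewrite -mulrA; apply: (@le_trans _ _ (M * x `^ (- (r0^-1 - r1^-1)))); last first.
    by rewrite ler_peMl ?(ltW B0).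
  rewrite powR_inv_le ?sum_powR_ge0 ?(ltW B0)//.
  (* The right-hand side is what results from summing [y^r1 <= T^(r1 - r0) y^r0], valid for
     [0 <= y < T]. *)
  have -> : (M * x `^ (- (r0^-1 - r1^-1))) `^ r1 = T `^ (r1 - r0) * M `^ r0.
    rewrite /T !powR_expR ?mulr_gt0 ?expR_gt0// !lnM ?posrE ?expR_gt0// !expRK.
    by rewrite -expRD; congr expR; field; rewrite !gt_eqF.
  apply: (@le_trans _ _ (\sum_(l <- nabla j) T `^ (r1 - r0) * `|a j l| `^ r0)).
    rewrite !big_seq; apply: ler_sum => l lj; rewrite Hb//.
    case: ifP => [_|/negbT].
      by rewrite normr0 powR0 ?gt_eqF// mulr_ge0 ?powR_ge0.
    rewrite -ltNge => aT.
    have -> : r1 = (r1 - r0) + r0 by rewrite subrK.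
    rewrite powRD; last by rewrite subrK gt_eqF.
    rewrite addrK; apply: ler_wpM2r; first exact: powR_ge0.
    by apply: ge0_ler_powR; rewrite ?nnegrE ?subr_ge0//; exact: ltW.
  by rewrite -mulr_sumr ler_wpM2l ?powR_ge0.
exists pred0; rewrite count_pred0; split; first exact: ltW.
move=> b Hb.
have ii : r0^-1 <= r1^-1 by rewrite lef_pV2 ?posrE.
rewrite max_r ?subr_le0// max_l ?subr_ge0// oppr0 powRr0 mulr1.
have B0 : 0 < 2 `^ r1^-1 * M * N `^ (r1^-1 - r0^-1).
  by rewrite !mulr_gt0 ?powR_gt0.
rewrite powR_inv_le ?sum_powR_ge0 ?(ltW B0)//.
(* Instead of Hoelder's inequality: [y^r1 <= U^r1 + U^(r1 - r0) y^r0] for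
   [r1 <= r0]; the price is the factor [2^(1/r1)]. *)
pose U := M * N `^ (- r0^-1).
have U0 : 0 < U by rewrite mulr_gt0 ?powR_gt0.
(* [U] is chosen to balance the two terms: [N U^r1] equals [U^(r1 - r0) M^r0], so their sum is twice
   either one. *)
have E1 : N * U `^ r1 = M `^ r1 * N `^ (1 - r1 / r0).
  rewrite /U powRM ?powR_ge0 ?(ltW M0)// mulrCA; congr (_ * _).
  rewrite -[in LHS](powRr1 (ltW N0)) -[in X in _ * X `^ _](powRr1 (ltW N0)).
  rewrite !powR_expR ?expR_gt0// !expRK -expRD; congr expR.
  by field; rewrite gt_eqF.
have E2 : U `^ (r1 - r0) * M `^ r0 = M `^ r1 * N `^ (1 - r1 / r0).
  rewrite /U !powR_expR ?mulr_gt0 ?expR_gt0// !lnM ?posrE ?expR_gt0// !expRK.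
  by rewrite -!expRD; congr expR; field; rewrite gt_eqF.
have E3 : (2 `^ r1^-1 * M * N `^ (r1^-1 - r0^-1)) `^ r1
    = M `^ r1 * N `^ (1 - r1 / r0) *+ 2.
  rewrite !powRM ?mulr_ge0 ?powR_ge0 ?(ltW M0)// -!powRrM mulVf ?gt_eqF//.
  rewrite powRr1// -mulrA mulr_natl mulrBl mulVf ?gt_eqF// [r1 / r0]mulrC.
  by [].
rewrite E3 mulr2n -{1}E1 -E2.
apply: (@le_trans _ _ (\sum_(l <- nabla j)
    (U `^ r1 + U `^ (r1 - r0) * `|a j l| `^ r0))).
  rewrite !big_seq; apply: ler_sum => l lj; rewrite Hb//=.
  have [aU|Ua] := leP `|a j l| U.
    rewrite (@le_trans _ _ (U `^ r1))//; last first.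
      by rewrite lerDl mulr_ge0 ?powR_ge0.
    by apply: ge0_ler_powR; rewrite ?nnegrE//; exact: ltW.
  rewrite (@le_trans _ _ (U `^ (r1 - r0) * `|a j l| `^ r0))//; last first.
    by rewrite lerDr powR_ge0.
  have -> : `|a j l| `^ r1 = `|a j l| `^ (r1 - r0) * `|a j l| `^ r0.
    rewrite -powRD ?subrK//; apply/implyP => _.
    by rewrite gt_eqF// (lt_trans U0).
  (* The exponent [r1 - r0] is nonpositive, so the power is decreasing in its base. *)
  rewrite ler_wpM2r ?powR_ge0// -opprB !powRN lef_pV2 ?posrE ?powR_gt0//.
    by apply: ge0_ler_powR; rewrite ?nnegrE ?subr_ge0// ltW.
  exact: lt_trans Ua.
rewrite big_split/= sum_const_count count_predT -mulr_sumr.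
by rewrite lerD ?ler_wpM2r ?ler_wpM2l ?powR_ge0.
Qed.

(** * From sets of kept positions to n-term approximation *)

(** The approximant copies [u] on [S]. Since [sigma_n] asks for exactly [n] admissible positions,
    [i0] fills the remaining slots with coefficient 0. *)
Lemma sigma_n_le (R : realType) d (nabla : nat -> {fset sidx d}) (s : R)
  (p q : \bar R) (n : nat) (u : seqsp R d) (i0 : nat * sidx d)
  (S : seq (nat * sidx d)) :
  i0.2 \in nabla i0.1 -> (forall i, i \in S -> i.2 \in nabla i.1) ->
  uniq S -> (size S <= n)%N ->
  (sigma_n nabla s p q n u <=
    bnorm nabla s p q (fun j l => if (j, l) \in S then 0%R else u j l))%E.
Proof.
move=> i0n Sn uS Sle; apply: ereal_inf_lbound.
exists (fun k => nth i0 S k).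
exists (fun k => if (k < size S)%N then u (nth i0 S k).1 (nth i0 S k).2 else 0).
split=> [k|].
  have [kS|Sk] := ltnP k (size S); first by rewrite Sn// mem_nth.
  by rewrite nth_default.
congr bnorm; apply/funext => j; apply/funext => l.
have E (k : 'I_n) : (j == (nth i0 S k).1) && (l == (nth i0 S k).2)
    = ((j, l) == nth i0 S k) by case: (nth i0 S k).
case: ifP => [jlS|jlS].
  (* As [S] has no repetition, only the summand at the index of [(j, l)] contributes. *)
  have iS : (index (j, l) S < size S)%N by rewrite index_mem.
  rewrite (bigD1 (Ordinal (leq_trans iS Sle)))//= iS nth_index//= /unitvec !eqxx.
  rewrite mulr1 big1 ?addr0 ?subrr// => k kn.
  rewrite E; case: ifP => kS; last by rewrite mul0r.
  case: eqP => jlk; last by rewrite mulr0.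
  by move: kn; rewrite -val_eqE/= jlk index_uniq// eqxx.
rewrite big1 ?subr0// => k _; case: ifP => kS; last by rewrite mul0r.
rewrite /unitvec E; case: eqP => jlk; last by rewrite mulr0.
by rewrite jlk mem_nth in jlS.
Qed.

(** The partial sums attain a largest value at some [L]; a nonzero term from [L] on would exceed
    it. *)
Lemma bounded_sum_eventually0 (f : nat -> nat) (n : nat) :
  (forall N, \sum_(0 <= j < N) f j <= n)%N ->
  exists L, forall j, (L <= j)%N -> f j = 0%N.
Proof.
move=> H.
have exP : exists m, `[< exists N, (\sum_(0 <= j < N) f j = m)%N >].
  by exists 0%N; apply/asboolP; exists 0%N; rewrite big_geq.
have ubP m : `[< exists N, (\sum_(0 <= j < N) f j = m)%N >] -> (m <= n)%N.
  by move=> /asboolP[N <-].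
case: (ex_maxnP exP ubP) => m /asboolP[L Lm] maxm.
exists L => j Lj.
have : (\sum_(0 <= i < j.+1) f i <= m)%N.
  by apply: maxm; apply/asboolP; exists j.+1.
rewrite (@big_cat_nat _ _ _ L)//=; last by rewrite (leq_trans Lj).
rewrite Lm -[leqRHS]addn0 leq_add2l leqn0 => /eqP.
by rewrite big_nat_recr//= => /eqP; rewrite addn_eq0 => /andP[_ /eqP].
Qed.

(** Although there are infinitely many levels, a finite total budget leaves only finitely many with
    a kept entry, so the kept positions form a list. *)
Lemma kept_entries d (nabla : nat -> {fset sidx d}) (P : nat -> pred (sidx d))
  (n : nat) :
  (forall N, \sum_(0 <= j < N) count (P j) (nabla j) <= n)%N ->
  exists S : seq (nat * sidx d),
    [/\ uniq S, (size S <= n)%N &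
        forall j l, ((j, l) \in S) = (l \in nabla j) && P j l].
Proof.
move=> H; have [L HL] := bounded_sum_eventually0 _ _ H.
exists [seq (j, l) | j <- iota 0 L, l <- [seq l <- nabla j | P j l]]; split.
- apply: allpairs_uniq_dep; first exact: iota_uniq.
    by move=> j _; apply: filter_uniq; exact: fset_uniq.
  by move=> [j l] [j' l'] _ _ /= [-> ->].
- rewrite size_allpairs_dep sumnE big_map.
  apply: leq_trans (H L); rewrite /index_iota subn0.
  by apply: leq_sum => j _; rewrite size_filter.
move=> j l; apply/allpairsPdep/andP => [[j' [l' [_]]]|[lj Pl]].
  by rewrite mem_filter => /andP[? ?] [-> ->].
exists j, l; rewrite mem_filter lj Pl mem_iota /= add0n; split => //.
rewrite ltnNge; apply/negP => /HL /eqP.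
by rewrite -leqn0 leqNgt -has_count => /hasP; case; exists l.
Qed.

(** * Consequences of the growth condition on [nabla] *)

(** Positivity of [C1] excludes an empty level [J]. The position found serves as padding for
    [sigma_n_le] and rules out [d = 0]. *)
Lemma nabla_growth_nonempty (R : realType) d (nabla : nat -> {fset sidx d}) :
  nabla_growth R nabla -> exists j l, l \in nabla j.
Proof.
move=> [C1 [C2 [J [C10 [_ /(_ J (leqnn J)) /andP[H _]]]]]].
have [E|/fset0Pn[l lJ]] := eqVneq (nabla J) fset0; last by exists J, l.
by move: H; rewrite E cardfs0 mulr0 leNgt C10.
Qed.

(** The finitely many levels below [J] are absorbed into the constant, because [2 ^ (j d)] is at
    least 1. *)
Lemma card_nabla_le (R : realType) d (nabla : nat -> {fset sidx d}) :
  nabla_growth R nabla -> exists C : R, 0 < C /\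
  forall j, (#|` nabla j|)%:R <= C * 2 `^ (j%:R * d%:R).
Proof.
move=> [C1 [C2 [J [C10 [C12 H]]]]].
have S0 : 0 <= \sum_(0 <= i < J) (#|` nabla i|)%:R :> R.
  by apply: sumr_ge0 => i _; exact: ler0n.
exists (C2 + \sum_(0 <= i < J) (#|` nabla i|)%:R); split.
  by rewrite ltr_wpDr// (lt_le_trans C10).
move=> j; rewrite mulrDl; have [Jj|jJ] := leqP J j.
  rewrite ler_wpDr ?mulr_ge0 ?powR_ge0//.
  have /andP[_] := H j Jj.
  by rewrite -natrM powR_mulrn// mulrC ler_pdivrMr ?exprn_gt0.
rewrite ler_wpDl ?mulr_ge0 ?powR_ge0// ?(le_trans (ltW C10))//.
apply: (@le_trans _ _ (\sum_(0 <= i < J) (#|` nabla i|)%:R)).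
  rewrite (@big_cat_nat _ _ _ j)//=; last exact: ltnW.
  rewrite [X in _ + X]big_ltn//= addrCA lerDl addr_ge0//.
    by apply: sumr_ge0 => i _; exact: ler0n.
  by apply: sumr_ge0 => i _; exact: ler0n.
by apply: ler_peMr => //; rewrite -natrM powR_mulrn// exprn_ege1// ler1n.
Qed.

(** * The upper bound *)

(** Both the number of kept entries and the remaining error decay geometrically in the distance of
    [j] from [kappa], so both can be summed over the levels. *)
Lemma level_keep (R : realType) d (nabla : nat -> {fset sidx d})
  (p0 p1 : \bar R) (s t C kappa delta : R) (a : seqsp R d) (j : nat) :
  (0 < p0)%E -> (0 < p1)%E -> 0 < C -> 0 < delta -> delta <= d%:R ->
  (#|` nabla j|)%:R <= C * 2 `^ (j%:R * d%:R) ->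
  weighted_level R d nabla (s + t) p0 a j <= 1 ->
  let D := Num.max (einv p0 - einv p1) 0 in
  exists P : pred (sidx d),
    (count P (nabla j))%:R
      <= C * 2 `^ (kappa * d%:R) * 2 `^ (- (delta * `|j%:R - kappa|)) /\
    forall b : seqsp R d,
      (forall l, l \in nabla j -> b j l = if P l then 0 else a j l) ->
      weighted_level R d nabla s p1 b j <=
        2 `^ einv p1 * C `^ (einv p1 - einv p0) * 2 `^ (- (kappa * t)) *
        2 `^ (- ((t - (d%:R + delta) * D) * `|j%:R - kappa|)).
Proof.
move=> p00 p10 C0 del0 deld HC Ha D.
have [kj|jk] := leP kappa j%:R; last first.
  (* Below [kappa] the whole level is kept and the error vanishes; [delta <= d] makes the level fit
     its budget. *)
  exists predT; rewrite count_predT; split.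
    apply: (le_trans HC); rewrite -mulrA ler_wpM2l ?(ltW C0)// -pow2D.
    rewrite ler_powR ?ler1n// ltr0_norm ?subr_lt0//.
    have : 0 <= (kappa - j%:R) * (d%:R - delta) by rewrite mulr_ge0 ?subr_ge0// ltW.
    lra.
  move=> b Hb; rewrite (@le_trans _ _ 0)//; last by rewrite !mulr_ge0 ?powR_ge0.
  rewrite /weighted_level mulr_ge0_le0 ?powR_ge0//.
  rewrite -[leRHS](mul0r ((#|` nabla j|)%:R `^ einv p1)).
  by apply: lp_level_le => // l lj; rewrite Hb// normr0.
rewrite ger0_norm ?subr_ge0//.
pose M : R := 2 `^ (- (j%:R * (s + t + d%:R * (2^-1 - einv p0)))).
have HM : lp_level nabla p0 a j <= M.
  rewrite /M powRN -[leRHS]mul1r ler_pdivlMr ?pow2_gt0// mulrC.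
  exact: Ha.
pose x : R := C * 2 `^ (kappa * d%:R) * 2 `^ (- (delta * (j%:R - kappa))).
have x0 : 0 < x by rewrite !mulr_gt0 ?pow2_gt0.
have N0 : 0 < C * 2 `^ (j%:R * d%:R) by rewrite mulr_gt0 ?pow2_gt0.
have [P [HP HB]] := level_approx _ _ _ _ p1 _ _ _ _ _ p00 p10 (pow2_gt0 R _) x0 N0 HC HM.
exists P; split => // b Hb.
apply: (@le_trans _ _ (2 `^ (j%:R * (s + d%:R * (2^-1 - einv p1))) *
  (2 `^ einv p1 * M * x `^ (- D) *
    (C * 2 `^ (j%:R * d%:R)) `^ Num.max (einv p1 - einv p0) 0))).
  by rewrite ler_wpM2l ?powR_ge0//; exact: HB.
(* [D] and the other maximum are the positive and negative parts of [einv p0 - einv p1]. *)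
have DD : einv p0 - einv p1 = D - Num.max (einv p1 - einv p0) 0.
  by rewrite /D; case: (leP (einv p0) (einv p1)) => h;
    [rewrite max_r ?max_l|rewrite max_l ?max_r]; lra.
move: (Num.max _ _) DD => D' DD; clearbody D.
have -> : einv p1 - einv p0 = D' - D by lra.
have i0E : einv p0 = einv p1 + D - D' by lra.
(* The two sides are equal: after passing to logarithms the exponents of 2 and of [C] agree. *)
rewrite le_eqVlt; apply/orP; left; apply/eqP; rewrite /M /x {}i0E.
rewrite !powR_expR ?mulr_gt0 ?expR_gt0// !lnM ?posrE ?mulr_gt0 ?expR_gt0//.
by rewrite !expRK -!expRD; congr expR; ring.
Qed.

Lemma worst_sigma_upper (R : realType) (d : nat) (nabla : nat -> {fset sidx d})
  (p0 p1 q0 q1 : \bar R) (s t : R) :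
  (0 < d)%N -> nabla_growth R nabla ->
  (0 < p0)%E -> (0 < p1)%E -> (0 < q0)%E -> (0 < q1)%E ->
  d%:R * Num.max (einv p0 - einv p1) 0 < t ->
  exists c : R, 0 < c /\ forall n : nat, (0 < n)%N ->
    (worst_sigma nabla s t p0 q0 p1 q1 n <= (c * n%:R `^ (- (t / d%:R)))%:E)%E.
Proof.
move=> d0 Hg p00 p10 q00 q10.
set D := Num.max _ 0 => Dt.
have D0 : 0 <= D by rewrite /D le_max lexx orbT.
have dR0 : 0 < d%:R :> R by rewrite ltr0n.
have [C [C0 HC]] := card_nabla_le R d nabla Hg.
have [j0 [l0 l0n]] := nabla_growth_nonempty R d nabla Hg.
(* Small enough that [delta * D < t - d * D], which gives [eta > 0], and at most [d] as [level_keep]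
   requires. *)
pose delta := Num.min d%:R ((t - d%:R * D) / (2 * (D + 1))).
have D1 : 0 < 2 * (D + 1) by lra.
have del0 : 0 < delta by rewrite lt_min dR0 divr_gt0// subr_gt0.
have deld : delta <= d%:R by rewrite ge_min lexx.
pose eta := t - (d%:R + delta) * D.
have eta0 : 0 < eta.
  have : delta <= (t - d%:R * D) / (2 * (D + 1)) by rewrite ge_min lexx orbT.
  rewrite ler_pdivlMr// => h; rewrite /eta.
  have : 0 < t - d%:R * D by rewrite subr_gt0.
  by lra.
have G0 := geo_bound_gt0 R delta del0.
(* With [2 ^ (kappa d) = c0 * n] the level budgets add up to at most [n]. *)
pose c0 := (C * geo_bound R delta)^-1.
have c00 : 0 < c0 by rewrite invr_gt0 mulr_gt0.
pose K := 2 `^ einv p1 * C `^ (einv p1 - einv p0).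
have K0 : 0 < K by rewrite mulr_gt0 ?powR_gt0.
exists (K * c0 `^ (- (t / d%:R)) * bnorm_const R eta q1); split.
  by rewrite !mulr_gt0 ?powR_gt0 ?bnorm_const_gt0.
move=> n n0; have nR0 : 0 < n%:R :> R by rewrite ltr0n.
(* The real solution of [2 ^ (kappa d) = c0 * n]; it need not be an integer and may be negative. *)
pose kappa := ln (c0 * n%:R) / (d%:R * ln 2).
have ln2 : 0 < ln 2 :> R by rewrite ln_gt0// ltr1n.
have Ekd : 2 `^ (kappa * d%:R) = c0 * n%:R.
  rewrite powR_expR// -[RHS]lnK ?posrE ?mulr_gt0//; congr expR.
  by rewrite /kappa; field; rewrite !gt_eqF.
have Ekt : 2 `^ (- (kappa * t)) = (c0 * n%:R) `^ (- (t / d%:R)).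
  rewrite !powR_expR ?mulr_gt0//; congr expR.
  by rewrite /kappa; field; rewrite !gt_eqF.
apply: ge_ereal_sup => _ [a /= Ha <-].
have Hlev j : weighted_level R d nabla (s + t) p0 a j <= 1.
  by rewrite -lee_fin; apply: le_trans Ha; exact: weighted_level_le_bnorm.
have /choice[P HP] := fun j =>
  level_keep R d nabla p0 p1 s t C kappa delta a j p00 p10 C0 del0 deld (HC j) (Hlev j).
have Hcnt N : (\sum_(0 <= j < N) count (P j) (nabla j) <= n)%N.
  rewrite -(ler_nat R) natr_sum.
  apply: (@le_trans _ _ (\sum_(0 <= j < N)
      C * 2 `^ (kappa * d%:R) * 2 `^ (- (delta * `|j%:R - kappa|)))).
    by apply: ler_sum => j _; exact: (HP j).1.
  rewrite -mulr_sumr Ekd.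
  apply: le_trans (ler_wpM2l _ (geo_sum _ _ _ _ del0)) _.
    by rewrite !mulr_ge0// ltW.
  by rewrite /c0 le_eqVlt; apply/orP; left; apply/eqP; field; rewrite !gt_eqF.
have [S [uS Sn HS]] := kept_entries _ _ _ _ Hcnt.
apply: le_trans (sigma_n_le _ _ _ _ _ _ _ a (j0, l0) S l0n _ uS Sn) _.
  by move=> [j l] /=; rewrite HS => /andP[].
have -> : K * c0 `^ (- (t / d%:R)) * bnorm_const R eta q1 * n%:R `^ (- (t / d%:R))
    = K * 2 `^ (- (kappa * t)) * bnorm_const R eta q1.
  by rewrite Ekt powRM ?(ltW c00)//; ring.
apply: (@bnorm_le _ _ _ _ _ _ _ _ kappa) => //.
  by rewrite mulr_ge0 ?powR_ge0 ?(ltW K0).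
move=> j; apply: (HP j).2 => l lj.
by rewrite HS lj.
Qed.

(** * The lower bound *)

(** The level is the integer logarithm of [n] to base [2 ^ d], raised by a fixed shift that reaches
    [J] and compensates for [C], the factor 2 and the rounding of the logarithm. *)
Lemma pow_level (R : realType) (d J : nat) (C : R) :
  (0 < d)%N -> 0 < C -> exists E : R, 0 < E /\
  forall n, (0 < n)%N -> exists j, (J <= j)%N /\
    (2 * n)%:R <= C * 2 `^ (j%:R * d%:R) /\ 2 `^ (j%:R * d%:R) <= E * n%:R.
Proof.
move=> d0 C0.
(* The Archimedean bound gives [J2 >= 2 * 2 ^ d / C], and [2 ^ (J2 d)] exceeds [J2]. *)
pose J2 := (J + Num.bound (2 * 2 ^+ d / C))%N.
have HJ2 : 2 * 2 ^+ d <= C * 2 ^+ (J2 * d).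
  rewrite [leRHS]mulrC -ler_pdivrMr//; apply: (@le_trans _ _ J2%:R).
    apply: (@le_trans _ _ (Num.bound (2 * 2 ^+ d / C))%:R).
      by apply: ltW; apply: archi_boundP; rewrite !mulr_ge0 ?exprn_ge0 ?invr_ge0 ?(ltW C0).
    by rewrite ler_nat leq_addl.
  rewrite -natrX ler_nat; apply: (@leq_trans (2 ^ J2)); first exact/ltnW/ltn_expl.
  by rewrite leq_exp2l// leq_pmulr.
exists (2 ^+ (J2 * d)); split; first exact: exprn_gt0.
move=> n n0; exists (trunc_log (2 ^ d) n + J2)%N.
have d1 : (1 < 2 ^ d)%N by rewrite -{1}(expn0 2) ltn_exp2l.
have /andP[lo hi] := trunc_log_bounds d1 n0.
set m := trunc_log _ n in lo hi *.
have E2 : 2 `^ ((m + J2)%:R * d%:R) = (2 ^ d)%:R ^+ m * 2 ^+ (J2 * d) :> R.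
  by rewrite -natrM powR_mulrn// mulnDl exprD natrX -exprM [(m * d)%N]mulnC.
split; first by rewrite (leq_trans _ (leq_addl _ _))// leq_addr.
rewrite E2; split; last first.
  by rewrite mulrC ler_wpM2l ?exprn_ge0// -natrX ler_nat.
rewrite mulrCA; apply: (@le_trans _ _ ((2 ^ d)%:R ^+ m * (2 * 2 ^+ d))); last first.
  by rewrite ler_wpM2l// exprn_ge0.
rewrite mulrCA natrM ler_wpM2l// -natrX -natrX -natrM ler_nat.
by rewrite -expnSr ltnW.
Qed.

Lemma count_notin (T : eqType) (s u : seq T) :
  uniq s -> (size s - size u <= count (fun l => l \notin u) s)%N.
Proof.
move=> us; rewrite leq_subLR -(count_predC (mem u) s) leq_add2r -size_filter.
apply: uniq_leq_size; first exact: filter_uniq.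
by move=> l; rewrite mem_filter => /andP[].
Qed.

(** An [n]-term combination can alter at most [n] of the at least [2 n] entries on level [j], so at
    least [n] entries of the difference still equal [alpha]. *)
Lemma bnorm_sub_combination_ge (R : realType) d (nabla : nat -> {fset sidx d})
  (s : R) (p q : \bar R) (n j : nat) (u : seqsp R d) (alpha : R)
  (idx : 'I_n -> nat * sidx d) (c : 'I_n -> R) :
  (0 < p)%E -> (0 < q)%E -> 0 <= alpha -> (0 < n)%N ->
  (2 * n <= #|` nabla j|)%N -> (forall l, l \in nabla j -> u j l = alpha) ->
  ((2 `^ (j%:R * (s + d%:R * (2^-1 - einv p))) * (alpha * n%:R `^ einv p))%:E <=
    bnorm nabla s p q
      (fun j l => (u j l - \sum_(k < n) c k * unitvec R (idx k).1 (idx k).2 j l)%R))%E.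
Proof.
move=> p0 q0 a0 n0 Hn Hu.
set b := fun j l => _.
apply: le_trans (weighted_level_le_bnorm R d nabla s p q b j q0).
rewrite lee_fin ler_wpM2l ?powR_ge0//.
apply: lp_level_ge; rewrite ?ltr0n// ler_nat.
(* Spatial indices are collected from terms of all levels; this can only enlarge the set of
   positions given up, and its size is still bounded by [n]. *)
pose v := [seq (idx k).2 | k <- enum 'I_n].
have vn : size v = n by rewrite size_map size_enum_ord.
have := count_notin _ (nabla j) v (fset_uniq _).
rewrite vn => Hc.
apply: (@leq_trans (size (nabla j) - n)); first by rewrite leq_subRL; lia.
apply: (leq_trans Hc).
apply: (@leq_trans (count (fun l => (l \in nabla j) && (l \notin v)) (nabla j))).
  by rewrite -size_filter -size_filter; apply: eq_leq; congr size; apply: eq_in_filter => l ->.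
apply: sub_count => l /andP[lj lv].
rewrite /b Hu// big1 ?subr0 ?ger0_norm// => k _.
rewrite /unitvec; case: eqP => [E|]; rewrite ?andbF ?mulr0//.
case: (l =P (idx k).2) => [E'|]; last by rewrite ?andbF mulr0.
by case/negP: lv; rewrite E'; apply/mapP; exists k; rewrite ?mem_enum.
Qed.

Lemma worst_sigma_lower (R : realType) (d : nat) (nabla : nat -> {fset sidx d})
  (p0 p1 q0 q1 : \bar R) (s t : R) :
  (0 < d)%N -> nabla_growth R nabla ->
  (0 < p0)%E -> (0 < p1)%E -> (0 < q0)%E -> (0 < q1)%E -> 0 < t ->
  exists c : R, 0 < c /\ forall n : nat, (0 < n)%N ->
    ((c * n%:R `^ (- (t / d%:R)))%:E <= worst_sigma nabla s t p0 q0 p1 q1 n)%E.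
Proof.
move=> d0 Hg p00 p10 q00 q10 t0.
have dR0 : 0 < d%:R :> R by rewrite ltr0n.
have [C [C0 HC]] := card_nabla_le R d nabla Hg.
case: Hg => C1 [C2 [J [C10 [_ HJ]]]].
have [E [E0 HE]] := pow_level R d J C1 d0 C10.
have i10 := einv_ge0 R p1 p10.
have B0 := bnorm_const_gt0 R 1 q0 ltr01 q00.
pose B := (bnorm_const R 1 q0)^-1.
have Bp : 0 < B by rewrite invr_gt0.
exists (B * C `^ (- einv p0) * E `^ (- einv p1) * E `^ (- (t / d%:R))); split.
  by rewrite !mulr_gt0 ?powR_gt0.
move=> n n0; have nR0 : 0 < n%:R :> R by rewrite ltr0n.
have [j [Jj [lo hi]]] := HE n n0.
have Hcard : (2 * n <= #|` nabla j|)%N.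
  rewrite -(ler_nat R) (le_trans lo)//.
  have /andP[+ _] := HJ j Jj.
  by rewrite -natrM powR_mulrn// [2 ^- _ * _]mulrC ler_pdivlMr ?exprn_gt0.
(* Normalised so that the weighted norm of level [j] is at most [B], hence [bnorm] at most 1. *)
pose alpha := B * C `^ (- einv p0) * 2 `^ (- (j%:R * (s + t + d%:R / 2))).
have alpha0 : 0 < alpha by rewrite !mulr_gt0 ?powR_gt0.
pose a : seqsp R d := fun i _ => if i == j then alpha else 0.
have Ha : (bnorm nabla (s + t) p0 q0 a <= 1)%E.
  have -> : 1%E = (B * bnorm_const R 1 q0)%:E by rewrite /B mulVf ?gt_eqF.
  (* The sequence lives on level [j] alone, so decay about the centre [j] holds at any rate; the
     rate 1 was fixed in [B]. *)
  apply: (@bnorm_le _ _ _ _ _ _ _ _ j%:R) => //; first exact: ltW.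
  move=> i; rewrite mul1r.
  have [->|ij] := eqVneq i j.
    rewrite subrr normr0 oppr0 powRr0 mulr1.
    apply: (@le_trans _ _ (2 `^ (j%:R * (s + t + d%:R * (2^-1 - einv p0))) *
        (alpha * (C * 2 `^ (j%:R * d%:R)) `^ einv p0))).
      rewrite ler_wpM2l ?powR_ge0//; apply: lp_level_le => //; first exact: ltW.
      by move=> l _; rewrite /a eqxx ger0_norm// ltW.
    rewrite le_eqVlt; apply/orP; left; apply/eqP; rewrite /alpha.
    rewrite !powR_expR ?mulr_gt0 ?expR_gt0// !lnM ?posrE ?mulr_gt0 ?expR_gt0//.
    rewrite !expRK mulrCA -!mulrA -[RHS]mulr1 -expR0; congr (_ * _).
    by rewrite -!expRD; congr expR; field.
  rewrite (@le_trans _ _ 0)//; last by rewrite mulr_ge0 ?powR_ge0 ?ltW.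
  rewrite mulr_ge0_le0 ?powR_ge0//.
  rewrite -[leRHS](mul0r ((#|` nabla i|)%:R `^ einv p0)).
  by apply: lp_level_le => // l _; rewrite /a (negbTE ij) normr0.
apply: (@le_trans _ _ (sigma_n nabla s p1 q1 n a)); last first.
  by apply: ereal_sup_ubound; exists a.
apply: le_ereal_inf_tmp => _ [idx [c [_ ->]]].
apply: le_trans (bnorm_sub_combination_ge _ _ _ _ _ _ _ j _ alpha _ _ p10 q10
  (ltW alpha0) n0 Hcard _); last first.
  by move=> l _; rewrite /a eqxx.
rewrite lee_fin.
have X0 : 0 < 2 `^ (j%:R * d%:R) :> R by exact: pow2_gt0.
(* The bound [2 ^ (j d) <= E * n] is used twice: [hi1] replaces the power of [n] by one of
   [2 ^ (j d)], and [hi2] bounds the surviving factor [2 ^ (- j t)] below by a power of [n]. *)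
have hi1 : (2 `^ (j%:R * d%:R) * E^-1) `^ einv p1 <= n%:R `^ einv p1.
  apply: ge0_ler_powR => //; rewrite ?nnegrE//.
    by rewrite mulr_ge0 ?powR_ge0 ?invr_ge0 ?(ltW E0).
  by rewrite ler_pdivrMr// [leRHS]mulrC.
have hi2 : (E * n%:R) `^ (- (t / d%:R)) <= 2 `^ (- (j%:R * t)).
  have -> : - (j%:R * t) = (j%:R * d%:R) * (- (t / d%:R)).
    by field; rewrite gt_eqF.
  rewrite [leRHS]powRrM !powRN lef_pV2 ?posrE ?powR_gt0 ?mulr_gt0//.
  apply: ge0_ler_powR; rewrite ?nnegrE ?divr_ge0 ?powR_ge0 ?mulr_ge0 ?(ltW t0) ?(ltW E0)//.
rewrite powRM ?(ltW E0)// in hi2.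
rewrite -[leLHS]mulrA.
apply: le_trans (ler_wpM2l _ hi2) _; first by rewrite !mulr_ge0 ?powR_ge0 ?(ltW Bp).
apply: le_trans; last first.
  apply: ler_wpM2l; first exact: powR_ge0.
  by apply: ler_wpM2l hi1; exact: ltW.
rewrite le_eqVlt; apply/orP; left; apply/eqP; rewrite /alpha.
rewrite -[E^-1]powR_inv1 ?(ltW E0)//.
rewrite !powR_expR ?mulr_gt0 ?expR_gt0// !lnM ?posrE ?mulr_gt0 ?expR_gt0//.
rewrite !expRK [in RHS]mulrCA -!mulrA; congr (_ * _).
rewrite -!expRD; congr expR.
by field.
Qed.

Theorem theorem7 (R : realType) (d : nat) (nabla : nat -> {fset sidx d})
  (p0 p1 q0 q1 : \bar R) (s t : R) :
  index_family nabla -> nabla_growth R nabla ->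
  (0 < p0)%E -> (0 < p1)%E -> (0 < q0)%E -> (0 < q1)%E ->
  0 < t -> d%:R * Num.max (einv p0 - einv p1) 0 < t ->
  exists c1 c2 : R, 0 < c1 /\ 0 < c2 /\
    forall n : nat, (0 < n)%N ->
      ((c1 * n%:R `^ (- (t / d%:R)))%:E <= worst_sigma nabla s t p0 q0 p1 q1 n)%E /\
      (worst_sigma nabla s t p0 q0 p1 q1 n <= (c2 * n%:R `^ (- (t / d%:R)))%:E)%E.
Proof.
move=> Hi Hg p00 p10 q00 q10 t0 Ht.
have d0 : (0 < d)%N.
  (* For [d = 0] the range from 1 to [2 ^ d - 1] is empty, while some [nabla j] is not. *)
  rewrite lt0n; apply/eqP => d0.
  have [j [l lj]] := nabla_growth_nonempty R d nabla Hg.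
  have /andP[l1 l2] := Hi j l lj.
  by move: (leq_trans l1 l2); rewrite [in (2 ^ d)%N]d0.
have [c1 [c10 H1]] :=
  worst_sigma_lower R d nabla p0 p1 q0 q1 s t d0 Hg p00 p10 q00 q10 t0.
have [c2 [c20 H2]] :=
  worst_sigma_upper R d nabla p0 p1 q0 q1 s t d0 Hg p00 p10 q00 q10 Ht.
by exists c1, c2; do ! split => //; [exact: H1 | exact: H2].
Qed.
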